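(* Every geometrically griddable permutation class is finitely based; that is, if $\mathcal{C}$ is a geometrically griddable class then there is a finite set $B$ of permutations such that $\mathcal{C}=\{\pi : \beta\not\le\pi \text{ for all } \beta\in B\}$.
   Context: A permutation of length $n\ge 0$ is a bijection of $\{1,\dots,n\}$, written in one-line notation. A permutation $\pi$ of length $n$ contains a permutation $\sigma$ of length $k$ (written $\sigma\le\pi$) if $\pi$ has a subsequence of length $k$ that is order isomorphic to $\sigma$. A permutation class is a set of permutations that is downward closed under $\le$. For every permutation class $\mathcal{C}$ there is a unique antichain $B$ (its basis, consisting of the minimal permutations not in $\mathcal{C}$) with $\mathcal{C}=\{\pi:\beta\not\le\pi\text{ for all }\beta\in B\}$; the class is finitely based if its basis is finite. Matrices are indexed first by column (left to right) and then by row (bottom to top); a $t\times u$ matrix has $t$ columns and $u$ rows. Let $M$ be a $t\times u$ matrix with entries in $\{0,1,-1\}$. The standard figure $\Lambda$ of $M$ is the subset of $\mathbb{R}^2$ consisting of the increasing open line segment from $(k-1,\ell-1)$ to $(k,\ell)$ for each $(k,\ell)$ with $M_{k,\ell}=1$, and the decreasing open line segment from $(k-1,\ell)$ to $(k,\ell-1)$ for each $(k,\ell)$ with $M_{k,\ell}=-1$. The geometric grid class $\operatorname{Geom}(M)$ is the set of all permutations obtained as follows: choose finitely many points of $\Lambda$, no two on a common horizontal or vertical line, label them $1,\dots,n$ from bottom to top, and read the labels from left to right. A permutation class is geometrically griddable if it is contained in $\operatorname{Geom}(M)$ for some matrix $M$ with entries in $\{0,1,-1\}$. *)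

(* Defs.v *)
From mathcomp Require Import all_boot all_order all_algebra all_fingroup.
From mathcomp Require Import all_classical all_reals.

Set Implicit Arguments.
Unset Strict Implicit.
Unset Printing Implicit Defensive.

Import Order.TTheory GRing.Theory Num.Theory.
Local Open Scope classical_set_scope.
Local Open Scope ring_scope.

(* Positions and values are 0-based: a permutation of length n is a bijection
   of {0, ..., n-1}, and [pi i] is the entry at position [i] of its one-line
   notation. *)
Definition permutation : Type := {n : nat & 'S_n}.

Definition plength (pi : permutation) : nat := tag pi.

Definition pentry (pi : permutation) : 'I_(plength pi) -> 'I_(plength pi) :=
  fun i => tagged pi i.
Arguments pentry : clear implicits.

(* [f] picks the positions of a subsequence of [pi] order isomorphic to
   [sigma]. *)
Definition pattern_le (sigma pi : permutation) : Prop :=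
  exists f : 'I_(plength sigma) -> 'I_(plength pi),
    (forall i j : 'I_(plength sigma), (i < j)%N -> (f i < f j)%N) /\
    (forall i j,
       (pentry sigma i < pentry sigma j)%N
         = (pentry pi (f i) < pentry pi (f j))%N).

Definition permutation_class (C : set permutation) : Prop :=
  forall sigma pi, C pi -> pattern_le sigma pi -> C sigma.

Definition avoiders (B : set permutation) : set permutation :=
  [set pi | forall beta, B beta -> ~ pattern_le beta pi].

Definition class_basis (C : set permutation) : set permutation :=
  [set beta | ~ C beta /\
     forall sigma, ~ C sigma -> pattern_le sigma beta -> sigma = beta].

Definition finitely_based (C : set permutation) : Prop :=
  finite_set (class_basis C).

(* The first index of the matrix is the column (left to right) and the second
   one the row (bottom to top). *)
Definition zero_pm1_matrix (t u : nat) (M : 'M[int]_(t, u)) : Prop :=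
  forall k l, M k l = 0 \/ M k l = 1 \/ M k l = -1.

(* With 0-based indices, the cell (k, l) is the square [k, k+1] x [l, l+1]. *)
Definition standard_figure (R : realType) (t u : nat) (M : 'M[int]_(t, u)) :
    set (R * R) :=
  [set p | exists (k : 'I_t) (l : 'I_u) (s : R),
     0 < s < 1 /\
     ((M k l = 1 /\ p = (k%:R + s, l%:R + s)) \/
      (M k l = -1 /\ p = (k%:R + s, l.+1%:R - s)))].

(* The chosen points are enumerated from left to right by [p]; the last clause
   says that [pi] labels them from bottom to top. *)
Definition Geom (R : realType) (t u : nat) (M : 'M[int]_(t, u)) :
    set permutation :=
  [set pi | exists p : 'I_(plength pi) -> R * R,
     [/\ forall i, standard_figure M (p i),
         forall i j : 'I_(plength pi), (i < j)%N -> (p i).1 < (p j).1,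
         forall i j, (p i).2 = (p j).2 -> i = j
       & forall i j, (pentry pi i < pentry pi j)%N = ((p i).2 < (p j).2)]].

Definition geometrically_griddable (R : realType) (C : set permutation) :
    Prop :=
  exists (t u : nat) (M : 'M[int]_(t, u)),
    zero_pm1_matrix M /\ C `<=` Geom R M.

(* Main.v *)
Require Import Defs.
From mathcomp Require Import all_boot all_order all_algebra all_fingroup.
From mathcomp Require Import all_classical all_reals.
From mathcomp Require Import zify lra.

Local Open Scope classical_set_scope.

Set Implicit Arguments.
Unset Strict Implicit.
Unset Printing Implicit Defensive.

Import Order.TTheory GRing.Theory Num.Theory.

(** A basis element [beta] of [C] with at least one entry loses its first entry
    to become a member of [C], hence of a geometric grid class; so the basis
    consists of one-point extensions of a geometric grid class, and it is an
    antichain. It is finite because these one-point extensions contain no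
    infinite antichain, which is seen by encoding them as words over a finite
    alphabet.

    In a geometric grid class, halve every cell in both directions and let [d]
    be the distance of a point, along the horizontal axis, to the nearest
    vertical side of its cell. Both segments of slope 1 and -1 are such that
    [d] is also the distance to the nearest horizontal side. Two points are
    compared horizontally by their half-columns, or, in the same half-column,
    by their values of [d]; the same holds vertically. So, once the points are
    listed by increasing [d], all comparisons can be read off from the list of
    half-cells ([unfold_lt]). Prepending a special letter for the deleted first
    entry, and marking on each other letter whether its entry lies above the
    deleted one, gives a word that determines [beta]
    ([Geom_extension_encodes]).

    As comparisons depend only on the two letters and on their order in the
    word, a subword encodes a contained permutation ([encodes_subseq]).
    Higman's lemma ([higman]) then yields, in any infinite sequence of basis
    elements, one that is contained in a later one. *)

(** * Higman's lemma over a finite alphabet *)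

Definition bad (A : eqType) (w : nat -> seq A) : Prop :=
  forall i j, i < j -> ~ subseq (w i) (w j).

Lemma ex_argmin (T : Type) (P : T -> Prop) (f : T -> nat) :
  (exists x, P x) -> exists2 x, P x & forall y, P y -> f x <= f y.
Proof.
case=> x; move: {2}(f x) (leqnn (f x)) => n.
elim: n x => [|n IHn] x le_fx_n Px.
  by exists x => // y _; rewrite (leq_trans le_fx_n).
have [[y Py lt_fy_fx]|minx] := pselect (exists2 y, P y & f y < f x).
  by apply: (IHn y) => //; rewrite -ltnS (leq_trans lt_fy_fx).
exists x => // y Py; rewrite leqNgt; apply/negP => lt_fy_fx.
by apply: minx; exists y.
Qed.

(** A minimal bad sequence in the sense of Nash-Williams. A stage of the
    construction is a whole bad sequence rather than a finite prefix: stage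
    [n.+1] keeps the first [n] words of stage [n] and makes word [n] as short
    as possible, so the stages converge pointwise. *)
Lemma minimal_bad (A : eqType) (g : nat -> seq A) :
  bad g ->
  exists2 m : nat -> seq A, bad m &
    forall n h, bad h -> (forall i, i < n -> h i = m i) ->
      size (m n) <= size (h n).
Proof.
move=> bad_g.
pose ok n (g1 h : nat -> seq A) := bad h /\ forall i, i < n -> h i = g1 i.
have /choice[step stepP] (ng : nat * (nat -> seq A)) : exists g',
    bad ng.2 -> ok ng.1 ng.2 g' /\
      forall h, ok ng.1 ng.2 h -> size (g' ng.1) <= size (h ng.1).
  have [bad_g1|not_bad] := pselect (bad ng.2); last by exists ng.2.
  have [|g' okg' ming'] := @ex_argmin _ (ok ng.1 ng.2) (fun h => size (h ng.1)).
    by exists ng.2.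
  by exists g'.
pose G := fix G n := if n is n'.+1 then step (n', G n') else g.
have bad_G n : bad (G n).
  by elim: n => // n IHn; have [[]] := stepP (n, G n) IHn.
have GS n i : i < n -> G n.+1 i = G n i.
  by move=> lt_in; have [[_ agree] _] := stepP (n, G n) (bad_G n); exact: agree.
have G_stable n i : i < n -> G n i = G i.+1 i.
  elim: n => // n IHn; rewrite ltnS leq_eqVlt => /predU1P[->//|lt_in].
  by rewrite GS // IHn.
exists (fun n => G n.+1 n) => [i j lt_ij | n h bad_h agree].
  by rewrite -(G_stable j.+1 i) ?ltnS 1?ltnW//; apply: bad_G.
have [_ /(_ h)] := stepP (n, G n) (bad_G n); apply; split=> // i lt_in.
by rewrite agree // [RHS]G_stable.
Qed.

Lemma infinite_pigeonhole (A : finType) (f : nat -> A) :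
  exists a, forall N, exists2 n, N <= n & f n = a.
Proof.
apply: contrapT => no_a.
have /fin_all_exists[N NP] (a : A) : exists N, forall n, N <= n -> f n <> a.
  apply: contrapT => noN; apply: no_a; exists a => N.
  apply: contrapT => no_n; apply: noN; exists N => n le_Nn fn.
  by apply: no_n; exists n.
exact: (NP _ (\max_a N a) (leq_bigmax (f (\max_a N a)))).
Qed.

(** The proof of Nash-Williams: in a minimal bad sequence, infinitely many words
    share a first letter, and deleting that letter produces a bad sequence that
    contradicts minimality. *)
Theorem higman (A : finType) (w : nat -> seq A) :
  exists i j, i < j /\ subseq (w i) (w j).
Proof.
apply: contrapT => no_ij.
have /minimal_bad[m bad_m min_m] : bad w.
  by move=> i j lt_ij sub_ij; apply: no_ij; exists i, j.
have m_nil n : m n != [::].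
  by apply/eqP => mn0; apply: (bad_m n n.+1) => //; rewrite mn0 sub0seq.
(* No word is empty, so [ohead] never returns [None] below. *)
have [oa oaP] := infinite_pigeonhole (fun n => ohead (m n)).
have [a mP] : exists a, forall N, exists n, N <= n /\ m n = a :: behead (m n).
  case: oa oaP => [a|] oaP.
    exists a => N; have [n le_Nn] := oaP N; case mn: (m n) => [|x u] //= [<-].
    by exists n; rewrite mn.
  by have [n _] := oaP 0; have := m_nil n; case: (m n).
have {mP}/choice[next nextP] := mP.
pose phi := fix phi i := next (if i is i'.+1 then (phi i').+1 else 0).
have m_phi i : m (phi i) = a :: behead (m (phi i)).
  by case: i => [|i]; apply: (nextP _).2.
have phi_incr : {homo phi : i j / i < j}.
  apply: homo_ltn => [? ? ?|i]; first exact: ltn_trans.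
  exact: (nextP (phi i).+1).1.
(* The minimal bad sequence is cut before a word with head [a] and continued by
   the tails of that word and of infinitely many later ones with head [a]. *)
pose h i := if i < phi 0 then m i else behead (m (phi (i - phi 0))).
have bad_h : bad h.
  move=> i j lt_ij; rewrite /h.
  case: ltnP => [lt_i|le_i]; case: ltnP => [lt_j|le_j].
  - exact: bad_m.
  - move=> /subseq_trans/(_ (subseq_cons _ a)); rewrite -m_phi; apply: bad_m.
    by apply: leq_trans lt_i _; case: (j - _) => // k; rewrite ltnW ?phi_incr.
  - by have := leq_ltn_trans le_i (ltn_trans lt_ij lt_j); rewrite ltnn.
  - move=> sub_ij; apply: (bad_m (phi (i - phi 0)) (phi (j - phi 0))).
      by apply: phi_incr; lia.
    by rewrite m_phi [X in subseq _ X]m_phi /= eqxx.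
have := min_m (phi 0) h bad_h; rewrite {2}/h ltnn subnn m_phi /= ltnn.
by case/(_ _)/notF => i lt_i; rewrite /h lt_i.
Qed.

(** * Permutations encoded by words *)

(** Here [s] lists the positions of [pi] in the order of the letters of [w].
    Since [X] and [Y] compare positions and values of any two entries from their
    letters, the earlier letter first, [w] determines [pi]. *)
Definition encodes (A : eqType) (X Y : rel A) (w : seq A) (pi : permutation)
    : Prop :=
  exists (s : seq 'I_(plength pi)) (a : 'I_(plength pi) -> A),
    [/\ uniq s, forall i, i \in s, w = map a s &
        pairwise (fun i j : 'I_(plength pi) => ((i < j) == X (a i) (a j)) &&
                    ((pentry pi i < pentry pi j) == Y (a i) (a j))) s].

Lemma pentry_inj (pi : permutation) : injective (pentry pi).
Proof. exact: perm_inj. Qed.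

Lemma neq_ltnN n (i j : 'I_n) : i != j -> (j < i) = ~~ (i < j).
Proof. by rewrite -val_eqE /= => neq_ij; lia. Qed.

(** Comparisons between two letters depend only on the letters and on their
    order in the word, and embedding a word as a subsequence of another keeps
    both. *)
Lemma encodes_subseq (A : eqType) (X Y : rel A) v w sigma pi :
  encodes X Y v sigma -> encodes X Y w pi -> subseq v w -> pattern_le sigma pi.
Proof.
case=> [s [a [s_uniq s_all -> s_pw]]] [s1 [b [s1_uniq _ -> s1_pw]]].
case/subseqP=> mk _; rewrite -map_mask; set s2 := mask mk s1 => eq_as_bs2.
have {s1_pw} s2_pw := subseq_pairwise (mask_subseq mk s1) s1_pw.
have {s1_uniq} s2_uniq : uniq s2 by rewrite mask_uniq.
have sz : size s2 = size s by rewrite -(size_map b) -eq_as_bs2 size_map.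
have idx_lt i : index i s < size s2 by rewrite sz index_mem.
have idx_inj i j : index i s = index j s -> i = j.
  by move/(congr1 (nth i s)); rewrite !nth_index.
(* Send the entry listed [k]-th by [s] to the one listed [k]-th by [s2]. The
   quantification over the default [d] spares an inhabitant of ['I_0]. *)
have /fin_all_exists[f fE] i : exists j, forall d, j = nth d s2 (index i s).
  have [d|] := pickP 'I_(plength pi); first by
    exists (nth d s2 (index i s)) => d'; apply: set_nth_default.
  by case: (s2) (idx_lt i) => // d s3 _ /(_ d).
have bf i : b (f i) = a i.
  rewrite (fE i (f i)) -(nth_map _ (a i)) // -eq_as_bs2.
  by rewrite (nth_map i) ?nth_index ?index_mem.
have before (i j : 'I_(plength sigma)) : index i s < index j s ->
    (i < j) = (f i < f j) /\
    (pentry sigma i < pentry sigma j)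
      = (pentry pi (f i) < pentry pi (f j)).
  move=> lt_ij.
  have /(pairwiseP i)/(_ (index i s) (index j s)) := s_pw.
  rewrite !inE !index_mem !nth_index //.
  move=> /(_ (s_all i) (s_all j) lt_ij)/andP[/eqP-> /eqP->].
  have /(pairwiseP (f i))/(_ (index i s) (index j s)) := s2_pw.
  rewrite !inE -!fE => /(_ (idx_lt i) (idx_lt j) lt_ij)/andP[/eqP-> /eqP->].
  by rewrite !bf.
have f_inj : injective f.
  move=> i j; rewrite (fE i (f i)) (fE j (f i)) => /eqP.
  by rewrite nth_uniq ?idx_lt // => /eqP/idx_inj.
have all_pairs (i j : 'I_(plength sigma)) :
    (i < j) = (f i < f j) /\ (pentry sigma i < pentry sigma j)
      = (pentry pi (f i) < pentry pi (f j)).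
  have [->|neq_ij] := eqVneq i j; first by rewrite !ltnn.
  have [/before//|/before[posE valE]|/idx_inj/eqP] :=
    ltngtP (index i s) (index j s); last by rewrite (negPf neq_ij).
  rewrite (@neq_ltnN _ j i) 1?eq_sym // posE.
  rewrite -neq_ltnN ?(inj_eq f_inj) 1?eq_sym //.
  rewrite (@neq_ltnN _ (pentry sigma j)) ?(inj_eq (@pentry_inj _)) 1?eq_sym //.
  rewrite valE -neq_ltnN //.
  by rewrite (inj_eq (@pentry_inj _)) (inj_eq f_inj) eq_sym.
exists f; split=> [i j|i j]; first by rewrite (all_pairs i j).1.
exact: (all_pairs i j).2.
Qed.

(** * Folding the cells of the figure *)

(** The coordinate of a point at distance [d] from the nearest side of its
    cell: [c.1] is the lower end of the cell, and [c.2] holds when that nearest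
    side is at its upper end. *)
Definition unfold (R : realType) (c : nat * bool) (d : R) : R :=
  (if c.2 then c.1%:R + 1 - d else c.1%:R + d)%R.

(** How [unfold c d] and [unfold c' d'] compare when [d <= d']: inside one half
    of a cell, the smaller distance comes first exactly in the lower half. *)
Definition lower (c c' : nat * bool) : bool :=
  (c.1 < c'.1) || ((c.1 == c'.1) && ~~ c.2).

Lemma unfold_lt (R : realType) (c c' : nat * bool) (d d' : R) :
  (0 < d <= 2^-1)%R -> (0 < d' <= 2^-1)%R -> (d <= d')%R ->
  unfold c d <> unfold c' d' -> (unfold c d < unfold c' d')%R = lower c c'.
Proof.
case: c c' => [k h] [k' h'] hd hd' le_dd'; rewrite /unfold /lower /=.
have step m m' : m < m' -> (m%:R + 1 <= m'%:R :> R)%R by rewrite natr1 ler_nat.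
have [/step lt_k|/step lt_k|<-] := ltngtP k k' => /=.
- by move=> _; apply/idP; case: h h' => -[]; lra.
- by move=> _; apply/negbTE; rewrite -leNgt; case: h h' => -[]; lra.
case: h h' => -[] /eqP ne /=.
- by apply/negbTE; rewrite -leNgt; lra.
- by apply/negbTE; rewrite -leNgt; lra.
- by rewrite lt_neqAle ne /=; lra.
- by rewrite lt_neqAle ne /=; lra.
Qed.

(** One distance serves for both coordinates because the segments are
    diagonals of their cells: a segment of slope 1 joins the halves of the same
    kind and a segment of slope -1 the halves of opposite kinds. *)
Lemma standard_figure_unfold (R : realType) t u (M : 'M[int]_(t, u)) p :
  standard_figure M p ->
  exists (c : ('I_t * bool) * ('I_u * bool)) (d : R),
    [/\ (0 < d <= 2^-1)%R, p.1 = unfold (val c.1.1, c.1.2) d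
      & p.2 = unfold (val c.2.1, c.2.2) d].
Proof.
case=> k [l [s [/andP[s_gt0 s_lt1] sP]]].
have [le_s|lt_s] := leP s (2^-1)%R.
  have hs : (0 < s <= 2^-1)%R by rewrite s_gt0.
  case: sP => [[_ ->]|[_ ->]].
    by exists ((k, false), (l, false)), s.
  exists ((k, false), (l, true)), s; split=> //=.
  by rewrite /unfold /= -natr1.
have hs : (0 < 1 - s <= 2^-1)%R by apply/andP; split; lra.
case: sP => [[_ ->]|[_ ->]].
  exists ((k, true), (l, true)), (1 - s)%R; split=> //=;
  by rewrite /unfold /=; lra.
exists ((k, true), (l, false)), (1 - s)%R; split=> //=;
rewrite /unfold /= -?natr1; lra.
Qed.

(** A half-column, a half-row, and whether the entry lies above the extra first
    entry. The extra entry itself is coded by [None]. *)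
Notation letter t u := (('I_t * bool) * ('I_u * bool) * bool)%type.

(** Only pairs [a], [b] with [a] first in the word matter, and [None] occurs
    once, as the first letter: other values with [None] are arbitrary. *)
Definition left_of t u (a b : option (letter t u)) : bool :=
  match a, b with
  | Some x, Some y => lower (val x.1.1.1, x.1.1.2) (val y.1.1.1, y.1.1.2)
  | _, _ => true
  end.

(** The same convention on [None] as for [left_of] applies. *)
Definition below t u (a b : option (letter t u)) : bool :=
  match a, b with
  | Some x, Some y => lower (val x.1.2.1, x.1.2.2) (val y.1.2.1, y.1.2.2)
  | None, Some y => y.2
  | _, None => true
  end.

Lemma ltn_bump2 h i j : (bump h i < bump h j) = (i < j).
Proof. by rewrite !ltnNge leq_bump2. Qed.

(** The listing is by increasing distance to the nearest side. Ties need no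
    care: two points with equal distances in the same half-column or half-row
    would share a coordinate. *)
Lemma Geom_extension_encodes (R : realType) t u (M : 'M[int]_(t, u)) n
    (sigma : 'S_n) (v : 'I_n.+1) :
  Geom R M (existT _ n sigma) ->
  exists w, encodes (@left_of t u) (@below t u) w
    (existT _ n.+1 (lift_perm ord0 v sigma)).
Proof.
case=> p [/= p_fig p_x p_y p_xy].
have /fin_all_exists[c /fin_all_exists[d cdP]] i :=
  standard_figure_unfold (p_fig i).
have p_x_inj i j : (p i).1 = (p j).1 -> i = j.
  move=> eq_x; apply/val_inj; have [/p_x|/p_x|//] := ltngtP i j;
  by rewrite eq_x ltxx.
have p_x_lt (i j : 'I_n) : (i < j) = ((p i).1 < (p j).1)%R.
  have [/p_x|/p_x/ltW|/val_inj->] := ltngtP i j; last by rewrite ltxx.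
  - by move->.
  - by rewrite leNgt => /negPf.
pose s0 := sort (fun i j => (d i <= d j)%R) (enum 'I_n).
have s0_pw : pairwise (fun i j => (d i <= d j)%R && (i != j)) s0.
  rewrite pairwise_relI -uniq_pairwise sort_uniq enum_uniq andbT.
  rewrite -sorted_pairwise => [|j i k]; last exact: le_trans.
  by apply: sort_sorted => i j; apply: le_total.
pose s := ord0 :: map (lift ord0) s0.
pose a i := omap (fun j => (c j, v < lift v (sigma j))) (unlift ord0 i).
have a0 : a ord0 = None by rewrite /a unlift_none.
have aS j : a (lift ord0 j) = Some (c j, v < lift v (sigma j)).
  by rewrite /a liftK.
exists (map a s), s, a; split=> //.
- rewrite /= map_inj_uniq ?sort_uniq ?enum_uniq ?andbT; last exact: lift_inj.
  by apply/mapP => -[j _ /eqP]; rewrite eq_liftF.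
- move=> i; rewrite inE; case: (unliftP ord0 i) => [j ->|->//].
  by rewrite map_f ?orbT // mem_sort mem_enum.
rewrite /s /= pairwise_map all_map; apply/andP; split.
  apply/allP => j _ /=.
  by rewrite a0 aS /pentry /= lift_perm_id lift_perm_lift /= eqxx.
apply: sub_pairwise s0_pw => i j /andP[le_d neq_ij].
rewrite /= !aS /pentry /= !lift_perm_lift /= !ltn_bump2.
have [d_i x_i y_i] := cdP i; have [d_j x_j y_j] := cdP j.
rewrite -!(unfold_lt d_i d_j le_d) -?x_i -?x_j -?y_i -?y_j.
- by rewrite p_x_lt p_xy !eqxx.
- by move/p_y/eqP; rewrite (negPf neq_ij).
- by move/p_x_inj/eqP; rewrite (negPf neq_ij).
Qed.

(** * Classes and their bases *)

Lemma pattern_le_trans (tau sigma pi : permutation) :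
  pattern_le tau sigma -> pattern_le sigma pi -> pattern_le tau pi.
Proof.
case=> f [f_mono fE] [g [g_mono gE]]; exists (g \o f); split=> i j.
  by move/f_mono/g_mono.
by rewrite fE gE.
Qed.

Lemma pattern_le_size (sigma pi : permutation) :
  pattern_le sigma pi -> plength sigma <= plength pi.
Proof.
case=> f [f_mono _].
have f_inj : injective f.
  move=> i j /(congr1 val) eq_f; apply/val_inj.
  by have [/f_mono|/f_mono|//] := ltngtP i j; rewrite eq_f ltnn.
by have := leq_card f f_inj; rewrite !card_ord.
Qed.

(** A strictly increasing map dominates the identity; conjugating by [rev_ord]
    gives the reverse inequality. *)
Lemma homo_ltn_ord_id n (f : 'I_n -> 'I_n) :
  (forall i j : 'I_n, i < j -> f i < f j) -> forall i, f i = i.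
Proof.
have ge_id (g : 'I_n -> 'I_n) :
    (forall i j : 'I_n, i < j -> g i < g j) -> forall i : 'I_n, i <= g i.
  move=> g_mono [k lt_kn] /=; elim: k lt_kn => // k IHk lt_kn.
  exact: leq_ltn_trans (IHk (ltnW lt_kn)) (g_mono (Ordinal (ltnW lt_kn)) _ _).
move=> f_mono i; apply/val_inj/eqP; rewrite eqn_leq (ge_id f) // andbT.
have := ge_id (fun j => rev_ord (f (rev_ord j))) _ (rev_ord i).
rewrite rev_ordK /= => le_rev; have := ltn_ord i; have := ltn_ord (f i).
suff /le_rev : forall j k : 'I_n, j < k ->
   rev_ord (f (rev_ord j)) < rev_ord (f (rev_ord k)) by rewrite /=; lia.
move=> j k lt_jk; have : f (rev_ord k) < f (rev_ord j).
  by apply: f_mono => /=; have := ltn_ord k; lia.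
by rewrite /=; have := ltn_ord (f (rev_ord j)); lia.
Qed.

Lemma pattern_le_eq (sigma pi : permutation) :
  pattern_le sigma pi -> plength sigma = plength pi -> sigma = pi.
Proof.
case: sigma pi => [n sigma] [m pi] /= + eq_nm.
case: m / eq_nm pi => pi [f [/homo_ltn_ord_id f_id]] /= fE.
have sigma_lt i j : (sigma i < sigma j) = (pi i < pi j).
  by have := fE i j; rewrite !f_id.
congr existT; apply/permP => i.
have homo_tau (j k : 'I_n) : j < k -> pi (sigma^-1 j)%g < pi (sigma^-1 k)%g.
  by rewrite -sigma_lt !permKV.
by rewrite -[LHS](homo_ltn_ord_id homo_tau) permK.
Qed.

(** A permutation outside [C] contains a shortest permutation outside [C], which
    is a basis element as containment between equal lengths is equality. *)
Lemma class_basisE (C : set permutation) :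
  permutation_class C -> C = avoiders (class_basis C).
Proof.
move=> classC; apply/seteqP; split=> pi => [Cpi beta [nCbeta _] le_beta|avoid_pi].
  exact: nCbeta (classC _ _ Cpi le_beta).
apply: contrapT => nCpi.
have [|beta [nCbeta le_beta] min_beta] := @ex_argmin _
  (fun sigma => ~ C sigma /\ pattern_le sigma pi) plength.
  by exists pi; split=> //; exists id.
apply: (avoid_pi beta) => //; split=> // sigma nCsigma le_sigma.
apply: (pattern_le_eq le_sigma); apply/eqP.
rewrite eqn_leq pattern_le_size //= min_beta //.
by split=> //; apply: pattern_le_trans le_sigma le_beta.
Qed.

(** Deleting the first entry [beta ord0] and standardizing the others leaves
    [sigma]. *)
Lemma lift_permP n (beta : 'S_n.+1) :
  exists sigma : 'S_n, beta = lift_perm ord0 (beta ord0) sigma.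
Proof.
have /fin_all_exists[f fE] (i : 'I_n) :
    exists j, beta (lift ord0 i) = lift (beta ord0) j.
  have /unlift_some[j -> _] : beta ord0 != beta (lift ord0 i).
    by rewrite (inj_eq perm_inj) neq_lift.
  by exists j.
have f_inj : injective f.
  move=> i j eq_f; apply: (@lift_inj _ ord0); apply: (@perm_inj _ beta).
  by rewrite !fE eq_f.
exists (perm f_inj); apply/permP => i.
case: (unliftP ord0 i) => [j ->|->]; last by rewrite lift_perm_id.
by rewrite lift_perm_lift permE fE.
Qed.

Lemma class_basis_encodes (R : realType) t u (M : 'M[int]_(t, u))
    (C : set permutation) (beta : permutation) :
  C `<=` Geom R M -> class_basis C beta -> 0 < plength beta ->
  exists w, encodes (@left_of t u) (@below t u) w beta.
Proof.
case: beta => [[//|n] beta] sub_C [_ min_beta] _.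
have [sigma betaE] := lift_permP beta.
rewrite betaE; apply: (@Geom_extension_encodes R _ _ M); apply: sub_C.
apply: contrapT => /min_beta sigma_eq.
suff /sigma_eq/(congr1 plength)/n_Sn : pattern_le (existT _ n sigma)
    (existT _ n.+1 beta) by [].
exists (lift ord0); split=> i j; first by rewrite /= ltn_bump2.
by rewrite /pentry /= betaE !lift_perm_lift /= ltn_bump2.
Qed.

(** An infinite basis would contain a sequence of distinct elements; the empty
    permutation is not among them since it is contained in all others. *)
Lemma finite_class_basis (R : realType) (C : set permutation) :
  geometrically_griddable R C -> finite_set (class_basis C).
Proof.
case=> t [u [M [_ sub_C]]]; apply: contrapT => /infiniteP/card_leP[f].
pose g n : permutation := val (f (to_setT n)).
have g_basis n : class_basis C (g n) by apply: set_mem; apply: valP.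
have g_inj : injective g.
  by move=> i j /val_inj/inj; rewrite !inE => /(_ I I)/(congr1 val).
have antichain i j : i < j -> ~ pattern_le (g i) (g j).
  move=> lt_ij /((g_basis j).2 _ (g_basis i).1)/g_inj eq_ij.
  by rewrite eq_ij ltnn in lt_ij.
have /choice[w wP] i : exists w, encodes (@left_of t u) (@below t u) w (g i).
  apply: (class_basis_encodes sub_C) => //; rewrite lt0n; apply/eqP => g0.
  apply: (antichain i i.+1) => //.
  have no_i (k : 'I_(plength (g i))) : False by case: k; rewrite g0.
  by exists (fun k => False_rect _ (no_i k)); split=> k; case: (no_i k).
have [i [j [lt_ij sub_ij]]] := higman w.
exact: antichain lt_ij (encodes_subseq (wP i) (wP j) sub_ij).
Qed.

Theorem theorem6p2 (R : realType) (C : set permutation)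
    (hclass : permutation_class C) (hgeom : geometrically_griddable R C) :
  finitely_based C /\
  exists B : set permutation, finite_set B /\ C = avoiders B.
Proof.
have finB := finite_class_basis hgeom.
by split=> //; exists (class_basis C); split=> //; apply: class_basisE.
Qed.
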